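(* Let $f:\mathbb{R}^N\to\mathbb{R}$ be strictly convex, self-concordant with constant $2$ and bounded below so that a minimizer exists. Suppose that the sequence $(x_k)_{k\in\mathbb{N}}$ is generated by the algorithm SIGMA with parameter $\mu\in(0,1)$, and write $\varepsilon:=\sqrt{1-\mu^2}$. There exist constants $\gamma_S,\gamma_N>0$ and $\bar\eta\in\left(0,\frac{3-\sqrt5}{2}\right)$ such that: (i) if $\lambda(x_k)>\bar\eta$ and the coarse step is taken, then $f(x_{k+1})-f(x_k)\le-\gamma_S$; (ii) if $\lambda(x_k)>\bar\eta$ and the fine step is taken, then $f(x_{k+1})-f(x_k)\le-\gamma_N$; (iii) if $\lambda(x_k)\le\bar\eta$ and the coarse step is taken, then SIGMA selects the unit step $t_k=1$ and $$\lambda(x_{k+1})\le\frac{\varepsilon+\lambda(x_k)}{(1-\lambda(x_k))^2}\,\lambda(x_k)<\lambda(x_k);$$ (iv) if $\lambda(x_k)\le\bar\eta$ and the fine step is taken, then SIGMA selects the unit step $t_k=1$ and $$\lambda(x_{k+1})\le\left(\frac{\lambda(x_k)}{1-\lambda(x_k)}\right)^2<\lambda(x_k).$$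
   Context: Self-concordance with constant $2$: $f$ is three times differentiable, convex, and for all $x,u\in\mathbb{R}^N$ the function $\phi(t)=f(x+tu)$ satisfies $|\phi'''(t)|\le 2\phi''(t)^{3/2}$. Strict convexity is used in the sense that $\nabla^2f(x)$ is positive definite. Operators: $n\le N$, $P\in\mathbb{R}^{N\times n}$ is a fixed matrix with full column rank $n$, and $R=P^T$. Reduced Hessian: $Q_H(x):=R\nabla^2f(x)P$. Coarse direction: $\hat d_k:=-P[Q_H(x_k)]^{-1}R\nabla f(x_k)$. Fine (Newton) direction: $d_{h,k}:=-[\nabla^2f(x_k)]^{-1}\nabla f(x_k)$. Approximate decrement: $\hat\lambda(x):=\left[(R\nabla f(x))^T[Q_H(x)]^{-1}R\nabla f(x)\right]^{1/2}$. Newton decrement: $\lambda(x):=\left[\nabla f(x)^T[\nabla^2f(x)]^{-1}\nabla f(x)\right]^{1/2}$. Algorithm SIGMA: inputs $\mu\in(0,1)$, $\alpha\in(0,0.5)$, $\beta\in(0,1)$, $\nu\in(0,0.68^2)$, tolerance $\epsilon\in(\nu,0.68^2)$ and $x_0\in\mathbb{R}^N$. At iteration $k$, set the direction $d_k$ equal to the coarse direction $\hat d_k$ if $\hat\lambda(x_k)>\mu\lambda(x_k)$ and $\hat\lambda(x_k)>\nu$ (''the coarse step is taken''), and to the Newton direction $d_{h,k}$ otherwise (''the fine step is taken''). Stop if $-\langle\nabla f(x_k),d_k\rangle\le\epsilon$. Otherwise determine $t_k$ by backtracking: start from $t_k=1$ and, while $f(x_k+t_kd_k)>f(x_k)+\alpha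 t_k\nabla f(x_k)^Td_k$, replace $t_k$ by $\beta t_k$. Set $x_{k+1}=x_k+t_kd_k$. *)

(* Defs.v *)
From HB Require Import structures.
From mathcomp Require Import all_boot all_order all_algebra.
From mathcomp Require Import all_classical all_reals all_analysis.

Set Implicit Arguments.
Unset Strict Implicit.
Unset Printing Implicit Defensive.

Import Order.TTheory GRing.Theory Num.Theory.
Import numFieldNormedType.Exports.

Local Open Scope classical_set_scope.
Local Open Scope ring_scope.

Section Calculus.
Variables (R : realType) (N : nat).
Implicit Types (f : 'cV[R]_N -> R) (x u v : 'cV[R]_N).

Definition dotv m (u v : 'cV[R]_m) : R := (u^T *m v) 0 0.

Definition grad f x : 'cV[R]_N := \col_i 'D_(delta_mx i 0) f x.

Definition hess f x : 'M[R]_N :=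
  \matrix_(i, j) 'D_(delta_mx j 0) (fun y => 'D_(delta_mx i 0) f y) x.

(* Frechet differentiability of f, of its gradient and of its Hessian (the
   third derivative need not be continuous). *)
Definition three_times_differentiable f : Prop :=
  forall x, [/\ differentiable f x,
                differentiable (grad f) x &
                differentiable (hess f) x].

Definition self_concordant f : Prop :=
  [/\ three_times_differentiable f,
      convex_function [set: 'cV[R]_N] f &
      forall x u (t : R), let phi := fun s : R => f (x + s *: u) in
        `|derive1n 3 phi t| <= 2 * (derive1n 2 phi t) `^ (3 / 2)].

(* Symmetry is not required: a Hessian is symmetric anyway. *)
Definition positive_definite (A : 'M[R]_N) : Prop :=
  forall v, v != 0 -> 0 < dotv v (A *m v).

Definition newton_dir f x : 'cV[R]_N := - (invmx (hess f x) *m grad f x).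

Definition newton_decr f x : R :=
  Num.sqrt (dotv (grad f x) (invmx (hess f x) *m grad f x)).

End Calculus.

Section Sigma.
Variables (R : realType) (N n : nat).
Variables (f : 'cV[R]_N -> R) (P : 'M[R]_(N, n)).
Implicit Types (x d : 'cV[R]_N) (t : R).

Definition reduced_grad x : 'cV[R]_n := P^T *m grad f x.

Definition reduced_hess x : 'M[R]_n := P^T *m hess f x *m P.

Definition coarse_dir x : 'cV[R]_N :=
  - (P *m (invmx (reduced_hess x) *m reduced_grad x)).

Definition approx_decr x : R :=
  Num.sqrt (dotv (reduced_grad x) (invmx (reduced_hess x) *m reduced_grad x)).

Definition coarse_taken (mu nu : R) x : bool :=
  (mu * newton_decr f x < approx_decr x) && (nu < approx_decr x).

Definition sigma_dir (mu nu : R) x : 'cV[R]_N :=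
  if coarse_taken mu nu x then coarse_dir x else newton_dir f x.

Definition sigma_stops (mu nu tol : R) x : bool :=
  - dotv (grad f x) (sigma_dir mu nu x) <= tol.

Definition sufficient_decrease (alpha : R) x d t : bool :=
  f (x + t *: d) <= f x + alpha * t * dotv (grad f x) d.

Definition backtracking_step (alpha beta : R) x d t : Prop :=
  exists m : nat,
    [/\ t = beta ^+ m,
        sufficient_decrease alpha x d (beta ^+ m) &
        forall j, (j < m)%N -> ~~ sufficient_decrease alpha x d (beta ^+ j)].

(* Iteration k is performed, that is x_(k+1) is computed, iff the stopping test
   has failed at iterations 0, ..., k. *)
Definition sigma_performs (mu nu tol : R) (x : nat -> 'cV[R]_N) (k : nat) :=
  forall j, (j <= k)%N -> ~~ sigma_stops mu nu tol (x j).

(* A run may be finite: once the stopping test has succeeded, the later terms of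
   x and t are arbitrary and play no role. *)
Definition sigma_run (mu alpha beta nu tol : R)
    (x : nat -> 'cV[R]_N) (t : nat -> R) : Prop :=
  forall k, sigma_performs mu nu tol x k ->
    backtracking_step alpha beta (x k) (sigma_dir mu nu (x k)) (t k) /\
    x k.+1 = x k + t k *: sigma_dir mu nu (x k).

End Sigma.

(* Main.v *)
(** The damped and quadratic phases both rest on how the local norm
    |v|_y = (v^T H(y) v)^(1/2), H = hess f, varies along a line y = x + s d.
    Self-concordance bounds only the diagonal D^3 f[u,u,u]; since D^3 f is
    symmetric, a theorem of Banach upgrades this, with the same constant, to
    |D^3 f[u,v,v]| <= 2 |u| |v|^2, so that with r = |d|_x the norms |v|_x and
    |v|_(x+d) agree up to a factor 1 - r and the Newton model of the gradient
    has error at most r^2 / (1 - r) in the dual norm.  Both directions of SIGMA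
    satisfy <grad f, d> = - r^2, where r is the exact or approximate decrement,
    and leave the residual grad f + H d of dual norm sqrt(lambda^2 - r^2); hence
      lambda(x + d) <= (sqrt(lambda^2 - r^2) + r^2 / (1 - r)) / (1 - r),
    where the square root is at most eps * lambda for a coarse step and 0 for a
    fine one.  The step sizes are controlled by the crude second-order bound
      f(x + t d) <= f(x) - t r^2 + (t r / (1 - t r))^2 / 2. *)

Require Import Defs.
From HB Require Import structures.
From mathcomp Require Import all_boot all_order all_algebra.
From mathcomp Require Import all_classical all_reals all_analysis.
From mathcomp Require Import ring lra.

Set Implicit Arguments.
Unset Strict Implicit.
Unset Printing Implicit Defensive.

Import Order.TTheory GRing.Theory Num.Theory.
Import numFieldNormedType.Exports.

Local Open Scope classical_set_scope.
Local Open Scope ring_scope.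

(** * Real functions *)

Lemma is_derive_MVT (R : realType) (f df : R -> R) (a b : R) : a <= b ->
  (forall x, a <= x <= b -> is_derive x 1 f (df x)) ->
  exists2 c, a <= c <= b & f b - f a = df c * (b - a).
Proof.
move=> ab fdf.
have [||c] := @MVT_segment R f df a b ab.
- by move=> x; rewrite in_itv /= => /andP[/ltW ax /ltW xb]; apply: fdf;
  rewrite ax.
- apply: derivable_within_continuous => x; rewrite in_itv/= => xab.
  by have [] := fdf x xab.
- by rewrite in_itv/=; exists c.
Qed.

Lemma is_derive_ge0_le (R : realType) (f df : R -> R) (a b : R) : a <= b ->
  (forall x, a <= x <= b -> is_derive x 1 f (df x)) ->
  (forall x, a <= x <= b -> 0 <= df x) -> f a <= f b.
Proof.
move=> ab fdf df0; have [c cab fE] := is_derive_MVT ab fdf.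
by rewrite -subr_ge0 fE mulr_ge0 ?subr_ge0// df0.
Qed.

(** Both sides are first-order Taylor remainders at 0. The difference [g1 - f1] is nondecreasing,
    hence stays above its initial value, and one use of the mean value theorem on [g - f] integrates
    this. *)
Lemma second_derivative_comparison (R : realType) (f f1 f2 g g1 g2 : R -> R)
    (b : R) : 0 <= b ->
  (forall x, 0 <= x <= b -> is_derive x 1 f (f1 x)) ->
  (forall x, 0 <= x <= b -> is_derive x 1 f1 (f2 x)) ->
  (forall x, 0 <= x <= b -> is_derive x 1 g (g1 x)) ->
  (forall x, 0 <= x <= b -> is_derive x 1 g1 (g2 x)) ->
  (forall x, 0 <= x <= b -> f2 x <= g2 x) ->
  f b - f 0 - b * f1 0 <= g b - g 0 - b * g1 0.
Proof.
move=> b0 df df1 dg dg1 fg2.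
have h1 x : 0 <= x <= b -> g1 0 - f1 0 <= g1 x - f1 x.
  move=> /andP[x0 xb].
  apply: (@is_derive_ge0_le _ (g1 - f1) (fun y => g2 y - f2 y)) => // y.
    move=> /andP[y0 yx]; have yb : 0 <= y <= b by rewrite y0 (le_trans yx).
    by apply: is_deriveB; [exact: dg1|exact: df1].
  move=> /andP[y0 yx]; have yb : 0 <= y <= b by rewrite y0 (le_trans yx).
  by rewrite subr_ge0 fg2.
have dgf x : 0 <= x <= b -> is_derive x 1 (g - f) (g1 x - f1 x).
  by move=> xb; apply: is_deriveB; [exact: dg|exact: df].
have [c cb cE] := is_derive_MVT b0 dgf.
have := ler_wpM2r b0 (h1 c cb).
by move: cE; rewrite subr0 /= !fctE => <-; lra.
Qed.

Lemma scalerE (R : realType) (a b : R) : a *: b = a * b.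
Proof. by []. Qed.

Lemma is_derive1V (R : realType) (f : R -> R) (x df : R) :
  is_derive x 1 f df -> f x != 0 ->
  is_derive x 1 (fun y => (f y)^-1) (- df * (f x)^-1 ^+ 2).
Proof.
move=> [fx <-] fx0; split; first exact: derivableV.
by rewrite deriveV// scalerE exprVn !mulNr mulrC.
Qed.

Lemma is_derive1M (R : realType) (f g : R -> R) (x df dg : R) :
  is_derive x 1 f df -> is_derive x 1 g dg ->
  is_derive x 1 (fun y => f y * g y) (df * g x + f x * dg).
Proof.
move=> dfx dgx; apply: (is_derive_eq (is_deriveM dfx dgx)).
by rewrite !scalerE; ring.
Qed.

Lemma is_derive1Z (R : realType) (f : R -> R) (x c df : R) :
  is_derive x 1 f df -> is_derive x 1 (fun y => c * f y) (c * df).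
Proof. by move=> dfx; exact: (is_deriveZ c dfx). Qed.

(** * Differential inequalities compared with [r / (1 - s r)], the solution of [q' = q^2],
    [q 0 = r] *)

Section RealDifferentialInequalities.
Variables (R : realType) (r b : R).
Hypothesis rb : forall s, 0 <= s <= b -> 0 < 1 - s * r.

Lemma is_derive_subl (s : R) : is_derive s 1 (fun s : R => 1 - s * r) (- r).
Proof.
have -> : (fun s : R => 1 - s * r) = cst 1 - r \*: id.
  by apply/funext => y /=; rewrite !fctE /= mulrC.
by apply: is_derive_eq; rewrite sub0r scalerE mulr1.
Qed.

Lemma is_derive_subl_inv (s : R) : 0 <= s <= b ->
  is_derive s 1 (fun s => (1 - s * r)^-1) (r * (1 - s * r)^-1 ^+ 2).
Proof.
move=> /rb s1; have s1N0 := lt0r_neq0 s1.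
apply: (is_derive_eq (is_derive1V (is_derive_subl s) s1N0)).
by rewrite opprK.
Qed.

Lemma is_derive_subl_inv2 (s : R) : 0 <= s <= b ->
  is_derive s 1 (fun s => (1 - s * r)^-1 ^+ 2) (2 * r * (1 - s * r)^-1 ^+ 3).
Proof.
move=> sb; have dk := is_derive_subl_inv sb.
apply: (is_derive_eq (is_derive1M dk dk)); ring.
Qed.

Let subb (s y : R) : 0 <= s <= b -> 0 <= y <= s -> 0 <= y <= b.
Proof. by move=> /andP[_ sb] /andP[-> ys]; exact: le_trans sb. Qed.

Variables (q dq : R -> R).
Hypothesis q_derive : forall s, 0 <= s <= b -> is_derive s 1 q (dq s).

(* The derivative of 1 / q is at least - 1. *)
Lemma riccati_upper (s : R) : 0 <= s <= b -> q 0 = r ->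
  (forall y, 0 <= y <= b -> 0 < q y) ->
  (forall y, 0 <= y <= b -> dq y <= q y ^+ 2) ->
  q s <= r * (1 - s * r)^-1.
Proof.
move=> sb q0r q0 dq2; have /andP[s0 sb'] := sb.
have r0 : 0 < r by rewrite -q0r q0// lexx (le_trans s0).
have dV (y : R) (ys : 0 <= y <= s) :=
  is_derive1V (q_derive (subb sb ys)) (lt0r_neq0 (q0 _ (subb sb ys))).
have [c cs h] := is_derive_MVT s0 dV.
have cb := subb sb cs.
have {}h : - s <= (q s)^-1 - r^-1.
  rewrite -q0r h subr0 !mulNr lerN2; apply: ler_piMl => //.
  by rewrite exprVn ler_pdivrMr ?exprn_gt0 ?q0// mul1r dq2.
rewrite ler_pdivlMr; last exact: rb.
have qs := q0 s sb.
have := ler_wpM2l (ltW (mulr_gt0 qs r0)) h.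
have -> : q s * r * ((q s)^-1 - r^-1) = r - q s by field; rewrite !gt_eqF.
lra.
Qed.

(** The integrating factor is [(1 - y r)^2], whose logarithmic derivative is [- 2 r / (1 - y r)]:
    its product with [q] is nonincreasing. *)
Lemma gronwall_upper (s : R) : 0 <= s <= b ->
  (forall y, 0 <= y <= b -> dq y <= 2 * (r * (1 - y * r)^-1) * q y) ->
  q s * (1 - s * r) ^+ 2 <= q 0.
Proof.
move=> sb dqM; have /andP[s0 _] := sb.
have dF (y : R) (ys : 0 <= y <= s) := is_derive1Z (- 1)
  (is_derive1M (q_derive (subb sb ys))
     (is_derive1M (is_derive_subl y) (is_derive_subl y))).
have h := is_derive_ge0_le s0 dF.
rewrite mul0r subr0 !mulr1 !mulN1r lerN2 -expr2 in h.
apply: h => y ys; have yb := subb sb ys.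
have l2 : 0 <= (1 - y * r) ^+ 2 by exact: sqr_ge0.
have := ler_wpM2r l2 (dqM y yb).
have -> : 2 * (r * (1 - y * r)^-1) * q y * (1 - y * r) ^+ 2 =
  2 * r * q y * (1 - y * r) by field; rewrite gt_eqF// rb.
lra.
Qed.

(** Here the integrating factor is [(1 - y r)^-2], and its product with [q] is nondecreasing. *)
Lemma gronwall_lower (s : R) : 0 <= s <= b ->
  (forall y, 0 <= y <= b -> - (2 * (r * (1 - y * r)^-1) * q y) <= dq y) ->
  q 0 <= q s * (1 - s * r)^-1 ^+ 2.
Proof.
move=> sb dqM; have /andP[s0 _] := sb.
have dF (y : R) (ys : 0 <= y <= s) :=
  is_derive1M (q_derive (subb sb ys)) (is_derive_subl_inv2 (subb sb ys)).
have h := is_derive_ge0_le s0 dF.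
rewrite mul0r subr0 invr1 expr1n mulr1 in h.
apply: h => y ys; have yb := subb sb ys.
have k2 : 0 <= (1 - y * r)^-1 ^+ 2 by exact: sqr_ge0.
have := ler_wpM2r k2 (dqM y yb); lra.
Qed.

End RealDifferentialInequalities.

Lemma second_order_bound (R : realType) (p p1 p2 : R -> R) (b C : R) : 0 <= b ->
  (forall y, 0 <= y <= b -> is_derive y 1 p (p1 y)) ->
  (forall y, 0 <= y <= b -> is_derive y 1 p1 (p2 y)) ->
  (forall y, 0 <= y <= b -> p2 y <= C) ->
  p b <= p 0 + b * p1 0 + C * b ^+ 2 / 2.
Proof.
move=> b0 dp dp1 pC.
have dg (y : R) : is_derive y 1 (fun y : R => C / 2 * (y * y)) (C * y).
  apply: (is_derive_eq (is_derive1Z (C / 2)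
    (is_derive1M (is_derive_id y 1) (is_derive_id y 1)))).
  by rewrite /=; field.
have dg1 (y : R) : is_derive y 1 (fun y : R => C * y) C.
  apply: (is_derive_eq (is_derive1Z C (is_derive_id y 1))).
  by rewrite mulr1.
have := second_derivative_comparison b0 dp dp1 (fun y _ => dg y)
  (fun y _ => dg1 y) pC.
lra.
Qed.

(** The comparison function is [V / (1 - y r)]: its second derivative is exactly the bound on [p2],
    and its Taylor remainder at 0 is the right-hand side. *)
Lemma second_order_remainder (R : realType) (p p1 p2 : R -> R) (r b V : R) :
  0 <= b -> (forall s, 0 <= s <= b -> 0 < 1 - s * r) ->
  (forall y, 0 <= y <= b -> is_derive y 1 p (p1 y)) ->
  (forall y, 0 <= y <= b -> is_derive y 1 p1 (p2 y)) ->
  (forall y, 0 <= y <= b ->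
     p2 y <= 2 * (V * (1 - y * r)^-1) * (r * (1 - y * r)^-1) ^+ 2) ->
  p b - p 0 - b * p1 0 <= V * ((1 - b * r)^-1 - 1 - b * r).
Proof.
move=> b0 rb dp dp1 pV.
have dg (y : R) (yb : 0 <= y <= b) := is_derive1Z V (is_derive_subl_inv rb yb).
have dg1 (y : R) : 0 <= y <= b ->
    is_derive y 1 (fun y => V * (r * (1 - y * r)^-1 ^+ 2))
    (2 * (V * (1 - y * r)^-1) * (r * (1 - y * r)^-1) ^+ 2).
  move=> yb; apply: (is_derive_eq
    (is_derive1Z V (is_derive1Z r (is_derive_subl_inv2 rb yb)))).
  by ring.
have := second_derivative_comparison b0 dp dp1 dg dg1 pV.
rewrite mul0r subr0 invr1 expr1n; lra.
Qed.

(** * Symmetric trilinear forms *)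

(** Angle trisection: with [th = acos x / 3] the triple-angle formulas give [x] and [|y|]. For
    negative [y] the angle [th] is replaced by [- th]. *)
Lemma unit_circle_trisection (R : realType) (x y : R) : x ^+ 2 + y ^+ 2 = 1 ->
  exists c s : R, [/\ c ^+ 2 + s ^+ 2 = 1, x = 4 * c ^+ 3 - 3 * c &
                      y = 3 * s - 4 * s ^+ 3].
Proof.
move=> xy1.
have x11 : -1 <= x <= 1 by apply/andP; split; nra.
pose th := acos x / 3.
have thE : acos x = th + (th + th) by rewrite /th; field.
have cs := sin2cos2 th.
have xE : x = 4 * cos th ^+ 3 - 3 * cos th.
  rewrite -[LHS]acosK// thE !cosD sinD.
  by ring: cs.
have yE : `|y| = 3 * sin th - 4 * sin th ^+ 3.
  rewrite -sqrtr_sqr (_ : y ^+ 2 = 1 - x ^+ 2); last by rewrite -xy1; ring.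
  rewrite -sin_acos// thE !sinD !cosD.
  by ring: cs.
have [y0|y0] := leP 0 y.
  by exists (cos th), (sin th); split; rewrite ?cos2Dsin2//;
    rewrite -yE ger0_norm.
exists (cos th), (- sin th); split; rewrite ?sqrrN ?cos2Dsin2//.
rewrite ltr0_norm// in yE.
by rewrite -[LHS]opprK yE; ring.
Qed.

(* Writing (a, b) = r (cos 3 th, sin 3 th), the number r is a convex combination
   of the values of the form at the three directions th + 2 k pi / 3, with
   weights (4 cos^2 - 1)^2 / 9 (an interpolation formula of M. Riesz type). *)
Lemma cubic_form_bound (R : realType) (a b c d M : R) :
  (forall x y, x ^+ 2 + y ^+ 2 = 1 ->
    `|a * x ^+ 3 + 3 * b * (x ^+ 2 * y) + 3 * c * (x * y ^+ 2) + d * y ^+ 3|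
      <= M) ->
  a ^+ 2 + b ^+ 2 <= M ^+ 2.
Proof.
move=> pM.
have M0 : 0 <= M.
  by apply: le_trans (pM 1 0 _) => //; rewrite expr1n expr0n addr0.
pose r := Num.sqrt (a ^+ 2 + b ^+ 2).
have r2 : r ^+ 2 = a ^+ 2 + b ^+ 2.
  by rewrite sqr_sqrtr// addr_ge0// sqr_ge0.
have r0 : 0 <= r by exact: sqrtr_ge0.
have [rz|rn0] := eqVneq r 0.
  by rewrite -r2 rz expr0n sqr_ge0.
have [C [S [CS aE bE]]] : exists C S : R, [/\ C ^+ 2 + S ^+ 2 = 1,
    a / r = 4 * C ^+ 3 - 3 * C & b / r = 3 * S - 4 * S ^+ 3].
  apply: unit_circle_trisection.
  by rewrite !expr_div_n -mulrDl -r2 divff// expf_neq0.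
have S2 : S ^+ 2 = 1 - C ^+ 2 by rewrite -CS; ring.
pose s : R := Num.sqrt 3.
have s2 : s ^+ 2 = 3 by rewrite sqr_sqrtr.
pose p x y : R :=
  a * x ^+ 3 + 3 * b * (x ^+ 2 * y) + 3 * c * (x * y ^+ 2) + d * y ^+ 3.
(* The points [(x1, y1)] and [(x2, y2)] are [(C, S)] rotated by [2 pi / 3] and [- 2 pi / 3]. *)
pose x1 : R := - C / 2 - s * S / 2.
pose y1 : R := s * C / 2 - S / 2.
pose x2 : R := - C / 2 + s * S / 2.
pose y2 : R := - s * C / 2 - S / 2.
have rE : r = (4 * C ^+ 2 - 1) ^+ 2 / 9 * p C S +
   (4 * x1 ^+ 2 - 1) ^+ 2 / 9 * p x1 y1 + (4 * x2 ^+ 2 - 1) ^+ 2 / 9 * p x2 y2.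
  have -> : r = (4 * C ^+ 3 - 3 * C) * a + (3 * S - 4 * S ^+ 3) * b.
    rewrite -aE -bE; apply: (mulIf rn0); rewrite -expr2 r2; field.
    exact: rn0.
  rewrite /p /x1 /y1 /x2 /y2.
  by field: S2 s2.
have w1 : (4 * C ^+ 2 - 1) ^+ 2 / 9 +
   (4 * x1 ^+ 2 - 1) ^+ 2 / 9 + (4 * x2 ^+ 2 - 1) ^+ 2 / 9 = 1.
  rewrite /x1 /y1 /x2 /y2.
  by field: S2 s2.
have bnd (x y : R) : x ^+ 2 + y ^+ 2 = 1 ->
    (4 * x ^+ 2 - 1) ^+ 2 / 9 * p x y <= (4 * x ^+ 2 - 1) ^+ 2 / 9 * M.
  move=> xy; apply: ler_wpM2l; first by rewrite divr_ge0// sqr_ge0.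
  exact: le_trans (ler_norm _) (pM _ _ xy).
have ME : M = (4 * C ^+ 2 - 1) ^+ 2 / 9 * M +
    (4 * x1 ^+ 2 - 1) ^+ 2 / 9 * M + (4 * x2 ^+ 2 - 1) ^+ 2 / 9 * M.
  by rewrite -[LHS]mul1r -[X in X * _]w1 2!mulrDl.
rewrite -r2 ler_sqr ?nnegrE// rE ME.
apply: lerD; [apply: lerD|]; apply: bnd => //;
  by rewrite /x1 /y1 /x2 /y2; field: S2 s2.
Qed.

Section QuadraticForms.
Variables (R : realType) (V : lmodType R) (B : V -> V -> R).
Hypothesis B_linear : forall a u u' v, B (a *: u + u') v = a * B u v + B u' v.
Hypothesis BC : forall u v, B u v = B v u.
Hypothesis B_gt0 : forall u, u != 0 -> 0 < B u u.

Let B_linearr a u v v' : B u (a *: v + v') = a * B u v + B u v'.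
Proof. by rewrite BC B_linear !(BC _ u). Qed.

Let B0 u : B 0 u = 0.
Proof. by have := B_linear 1 0 0 u; rewrite scaler0 addr0; lra. Qed.

Lemma form_ge0 u : 0 <= B u u.
Proof.
by have [->|u0] := eqVneq u 0; [rewrite B0|exact/ltW/B_gt0].
Qed.

Lemma form_Cauchy_Schwarz u v : B u v <= Num.sqrt (B u u) * Num.sqrt (B v v).
Proof.
have [->|v0] := eqVneq v 0; first by rewrite BC !B0 sqrtr0 mulr0.
have Bv := B_gt0 v0.
rewrite -sqrtrM ?form_ge0// (le_trans (ler_norm _))// -sqrtr_sqr ler_wsqrtr//.
(* The component of [u] orthogonal to [v] has squared length [B u u - (B u v)^2 / B v v], which is
   nonnegative. *)
have := form_ge0 (- (B u v / B v v) *: v + u).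
rewrite !(B_linear, B_linearr) (BC v u) => h.
rewrite -subr_ge0 -(pmulr_lge0 _ (x := (B v v)^-1)) ?invr_gt0//.
by apply: le_trans h _; rewrite le_eqVlt; apply/orP; left; apply/eqP; field;
  rewrite gt_eqF.
Qed.

Variables (T : V -> V -> V -> R) (M : R).
Hypothesis T_linear :
  forall a u u' v w, T (a *: u + u') v w = a * T u v w + T u' v w.
Hypothesis TC12 : forall u v w, T u v w = T v u w.
Hypothesis TC23 : forall u v w, T u v w = T u w v.
Hypothesis T_bound : forall u, B u u <= 1 -> `|T u u u| <= M.

Let T0 v w : T 0 v w = 0.
Proof. by have := T_linear 1 0 0 v w; rewrite scaler0 addr0; lra. Qed.

(* In a B-orthonormal basis e1, e2 of the span of v and u, with e1 along v, the
   diagonal of T is a cubic form in two variables; if u and v are parallel then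
   e2 is 0, since 0^-1 = 0. *)
Lemma symmetric_trilinear_bound u v :
  `|T u v v| <= M * Num.sqrt (B u u) * B v v.
Proof.
have [->|v0] := eqVneq v 0; first by rewrite TC12 T0 B0 normr0 mulr0.
have M0 : 0 <= M by apply: le_trans (T_bound (u := 0) _) => //; rewrite B0.
have Bv := B_gt0 v0.
pose nv : R := Num.sqrt (B v v).
have nv0 : 0 < nv by rewrite sqrtr_gt0.
have nv2 : nv ^+ 2 = B v v by rewrite sqr_sqrtr// ltW.
have BZ a x y : B (a *: x) y = a * B x y.
  by rewrite -[a *: x]addr0 B_linear B0 addr0.
have TZ a x y z : T (a *: x) y z = a * T x y z.
  by rewrite -[a *: x]addr0 T_linear T0 addr0.
have [e1 e1E] : exists e, e = nv^-1 *: v by exists (nv^-1 *: v).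
have vE : v = nv *: e1 by rewrite e1E scalerA divff ?scale1r// gt_eqF.
have B11 : B e1 e1 = 1.
  by rewrite e1E BZ BC BZ -nv2; field; rewrite gt_eqF.
pose p : R := B u e1.
pose w := - p *: e1 + u.
have Bw1 : B w e1 = 0 by rewrite /w B_linear B11 /p; ring.
pose nw : R := Num.sqrt (B w w).
have nw2 : nw ^+ 2 = B w w by rewrite sqr_sqrtr// form_ge0.
have [e2 e2E] : exists e, e = nw^-1 *: w by exists (nw^-1 *: w).
have wE : w = nw *: e2.
  rewrite e2E scalerA; have [nw0|nw0] := eqVneq nw 0;
    last by rewrite divff ?scale1r.
  rewrite nw0 mul0r scale0r; apply/eqP/negP => /negP/B_gt0.
  by rewrite -nw2 nw0 expr0n ltxx.
have B22 : B e2 e2 <= 1.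
  rewrite e2E BZ BC BZ -nw2 mulrA -expr2 exprVn.
  have [->|nw0] := eqVneq nw 0; first by rewrite expr0n mulr0 ler01.
  by rewrite mulVf// expf_neq0.
have B21 : B e2 e1 = 0 by rewrite e2E BZ Bw1 mulr0.
have uE : u = p *: e1 + nw *: e2 by rewrite -wE /w scaleNr addNKr.
have B_comb a x b y z : B (a *: x + b *: y) z = a * B x z + b * B y z.
  by rewrite B_linear BZ.
have T_comb a x b y z t : T (a *: x + b *: y) z t = a * T x z t + b * T y z t.
  by rewrite T_linear TZ.
have T_comb2 a x b y z t : T z (a *: x + b *: y) t = a * T z x t + b * T z y t.
  by rewrite TC12 T_comb !(TC12 _ z).
have T_comb3 a x b y z t : T z t (a *: x + b *: y) = a * T z t x + b * T z t y.
  by rewrite TC23 T_comb2 !(TC23 _ _ t).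
have BE x y : B (x *: e1 + y *: e2) (x *: e1 + y *: e2) =
    x ^+ 2 + y ^+ 2 * B e2 e2.
  by rewrite B_comb !(BC _ (_ + _)) !B_comb (BC e1 e2) B21 B11; ring.
have Bu : B u u = p ^+ 2 + nw ^+ 2.
  by rewrite {1 2}uE BE {2}nw2 wE (BZ nw e2) (BC e2 (nw *: e2)) (BZ nw e2);
    ring.
(* The diagonal of [T] at [x e1 + y e2] is a cubic form in [(x, y)]. On the unit circle this vector
   stays in the unit ball of [B], possibly in its interior when [e2] is 0, so [T_bound] applies. *)
have ab : T e1 e1 e1 ^+ 2 + T e2 e1 e1 ^+ 2 <= M ^+ 2.
  apply: (@cubic_form_bound _ _ _ (T e2 e2 e1) (T e2 e2 e2)) => x y xy.
  have /T_bound : B (x *: e1 + y *: e2) (x *: e1 + y *: e2) <= 1.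
    by rewrite BE -xy lerD// ler_piMr// sqr_ge0.
  rewrite !(T_comb, T_comb2, T_comb3).
  rewrite (TC23 e1 e1 e2) !(TC12 e1 e2) (TC23 e2 e1 e2).
  by congr (`| _ | <= _); ring.
have Tu : T u v v = B v v * (p * T e1 e1 e1 + nw * T e2 e1 e1).
  rewrite {1}uE T_comb vE !(TC12 _ (nv *: e1)) !TZ !(TC23 _ _ (nv *: e1)).
  by rewrite !(TC12 _ (nv *: e1)) !TZ (TC23 e1 e1 e2) (TC12 e1 e2) -vE -nv2;
    ring.
(* What remains is Cauchy-Schwarz in the plane for [(p, nw)], of length [|u|], and the two
   coefficients of [T], of length at most [M]; it follows from Lagrange's identity. *)
rewrite Tu normrM (gtr0_norm Bv) mulrC ler_wpM2r ?(ltW Bv)//.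
rewrite -sqrtr_sqr -{1}(ger0_norm M0) -sqrtr_sqr -sqrtrM ?sqr_ge0//.
rewrite ler_wsqrtr// Bu.
move: (T e1 e1 e1) (T e2 e1 e1) ab => a b ab.
have pn : 0 <= p ^+ 2 + nw ^+ 2 by rewrite addr_ge0// sqr_ge0.
apply: le_trans (ler_wpM2r pn ab).
rewrite -subr_ge0 (_ : _ - _ = (p * b - nw * a) ^+ 2) ?sqr_ge0//.
by ring.
Qed.

End QuadraticForms.

(** * Higher derivatives *)

Lemma differentiable_bound (R : realType) (V W : normedModType R) (g : V -> W)
    (x : V) : differentiable g x -> forall e, 0 < e ->
  exists2 r, 0 < r & forall h, `|h| < r ->
    `|g (x + h) - g x - 'd g x h| <= e * `|h|.
Proof.
move=> gx e e0.
have /eqaddoP/(_ e e0) := diff_locally gx.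
move=> /nbhs_ballP[r /= r0 H]; exists r => // h hr.
have /H : ball 0 r h by rewrite -ball_normE /= sub0r normrN.
by rewrite /= fctE /= opprD addrA (addrC h).
Qed.

Lemma is_derive_line (R : realType) (V W : normedModType R) (g : V -> W)
    (x v : V) (s : R) : differentiable g (x + s *: v) ->
  is_derive s 1 (fun s => g (x + s *: v)) ('D_v g (x + s *: v)).
Proof.
move=> gd; have dg := diff_derivable (v := v) gd.
suff E : (fun h : R => h^-1 *: (((fun s => g (x + s *: v)) \o shift s) (h *: 1)
            - g (x + s *: v))) =
    (fun h => h^-1 *: ((g \o shift (x + s *: v)) (h *: v) - g (x + s *: v))).
  by split; rewrite /derivable /derive E.
apply/funext => h /=; congr (_ *: (g _ - _)).
by rewrite scalerDl [h *: 1]mulr1 addrCA.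
Qed.

(** Being symmetric in [u] and [v], this quantity links the two orders of differentiation: divided
    by [t^2], it approximates either mixed derivative. *)
Definition second_difference (R : realType) (V : normedModType R) (g : V -> R)
  (x u v : V) (t : R) : R :=
  g (x + t *: v + t *: u) - g (x + t *: u) - (g (x + t *: v) - g x).

Lemma second_differenceC (R : realType) (V : normedModType R) (g : V -> R)
    (x u v : V) (t : R) :
  second_difference g x u v t = second_difference g x v u t.
Proof. by rewrite /second_difference (addrAC x (t *: v)); ring. Qed.

(** The mean value theorem in the direction [u] turns the second difference into [t] times a
    difference of two values of ['D_u g] near [x]. Both are then expanded to first order at [x],
    where the contributions of [xi u] cancel. *)
Lemma second_difference_approx (R : realType) (V : normedModType R) (g : V -> R)
    (x u v : V) : (forall y, differentiable g y) ->
  differentiable ('D_u g) x -> forall e, 0 < e ->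
  exists2 r, 0 < r & forall t, 0 < t < r ->
    `|second_difference g x u v t - t ^+ 2 * 'D_v ('D_u g) x| <= e * t ^+ 2.
Proof.
move=> gd gu e e0.
(* Both increments, [xi u] and [t v + xi u], have norm at most [t K]; the summand 1 keeps [K]
   positive. Two expansion errors share [e], hence the factor 2 in [e / (2 * K)]. *)
pose K := `|u| + `|v| + 1.
have K0 : 0 < K by rewrite ltr_wpDl// addr_ge0.
have e'0 : 0 < e / (2 * K) by rewrite divr_gt0// mulr_gt0.
have [r r0 H] := differentiable_bound gu e'0.
exists (r / K); first by rewrite divr_gt0.
move=> t /andP[t0 tr].
have tK : t * K < r by rewrite -ltr_pdivlMr.
pose phi s := g (x + t *: v + s *: u) - g (x + s *: u).
have dphi (s : R) : is_derive s 1 phi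
    ('D_u g (x + t *: v + s *: u) - 'D_u g (x + s *: u)).
  by apply: is_deriveB; exact: is_derive_line.
have [xi /andP[xi0 xit]] := is_derive_MVT (ltW t0) (fun s _ => dphi s).
rewrite subr0 {1 2}/phi scale0r !addr0 -/(second_difference g x u v t) => ->.
rewrite (deriveE v gu).
have n1 : `|xi *: u| <= t * `|u| by rewrite normrZ (ger0_norm xi0) ler_wpM2r.
have n2 : `|t *: v + xi *: u| <= t * (`|u| + `|v|).
  by rewrite (le_trans (ler_normD _ _))// normrZ (gtr0_norm t0) mulrDr addrC
    lerD.
have h1 := H (xi *: u); have h2 := H (t *: v + xi *: u).
set a1 := 'D_u g (x + xi *: u) in h1 *.
rewrite -addrA; set a2 := 'D_u g (x + _) in h2 *.
have tuK : t * `|u| <= t * K by rewrite ler_wpM2l ?(ltW t0)// /K -addrA lerDl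
  addr_ge0.
have tuvK : t * (`|u| + `|v|) <= t * K by rewrite ler_wpM2l ?(ltW t0)// lerDl.
have {}h1 := h1 (le_lt_trans (le_trans n1 tuK) tK).
have {}h2 := h2 (le_lt_trans (le_trans n2 tuvK) tK).
have E : (a2 - a1) * t - t ^+ 2 * 'd ('D_u g) x v =
  ((a2 - 'D_u g x - 'd ('D_u g) x (t *: v + xi *: u)) -
   (a1 - 'D_u g x - 'd ('D_u g) x (xi *: u))) * t.
  have -> : 'd ('D_u g) x (t *: v + xi *: u) =
      t * 'd ('D_u g) x v + 'd ('D_u g) x (xi *: u).
    by rewrite linearD linearZ.
  by ring.
rewrite E normrM (gtr0_norm t0).
have -> : e * t ^+ 2 = (e / (2 * K) * (t * K) + e / (2 * K) * (t * K)) * t.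
  by field; exact: lt0r_neq0.
rewrite ler_wpM2r ?(ltW t0)// (le_trans (ler_normB _ _))// lerD//.
  by rewrite (le_trans h2)// ler_wpM2l ?(ltW e'0)// (le_trans n2).
by rewrite (le_trans h1)// ler_wpM2l ?(ltW e'0)// (le_trans n1).
Qed.

(** Young's form of the symmetry theorem, resting on differentiability of the first derivatives at
    [x]: for small [t] both mixed derivatives times [t^2] lie within [e / 2 * t^2] of the same
    second difference. *)
Lemma derive_comm (R : realType) (V : normedModType R) (g : V -> R)
    (x u v : V) : (forall y, differentiable g y) ->
  differentiable ('D_u g) x -> differentiable ('D_v g) x ->
  'D_v ('D_u g) x = 'D_u ('D_v g) x.
Proof.
move=> gd gu gv; apply/eqP; rewrite -subr_eq0 -normr_le0.
apply/ler_addgt0Pr => e e0; rewrite add0r.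
have e20 : 0 < e / 2 by rewrite divr_gt0.
have [r1 r10 H1] := second_difference_approx v gd gu e20.
have [r2 r20 H2] := second_difference_approx u gd gv e20.
pose t := Num.min r1 r2 / 2.
have m0 : 0 < Num.min r1 r2 by rewrite lt_min r10.
have t0 : 0 < t by rewrite divr_gt0.
have tm : t < Num.min r1 r2 by rewrite ltr_pdivrMr// ltr_pMr// ltr1n.
have := H1 t; have := H2 t.
rewrite t0 (lt_le_trans tm) ?ge_min ?lexx ?orbT//.
rewrite (lt_le_trans tm) ?ge_min ?lexx ?orbT//.
rewrite second_differenceC => /(_ isT); set S := second_difference _ _ _ _ _.
set A := 'D_u ('D_v g) x; set B := 'D_v ('D_u g) x => hA /(_ isT) hB.
have t20 : 0 < t ^+ 2 by rewrite exprn_gt0.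
rewrite -(ler_pM2r t20) -{1}(gtr0_norm t20) -normrM.
have -> : (B - A) * t ^+ 2 = (S - t ^+ 2 * A) - (S - t ^+ 2 * B) by ring.
rewrite (le_trans (ler_normB _ _))//.
have -> : e * t ^+ 2 = e / 2 * t ^+ 2 + e / 2 * t ^+ 2 by field.
exact: (lerD hA hB).
Qed.

(** * Differentiating linear forms of matrix-valued maps *)

Section LinearForms.
Variables (R : realType) (m n : nat) (L : 'M[R]_(m, n) -> R).
Hypothesis linL : forall (a : R) A B, L (a *: A + B) = a * L A + L B.

Lemma mx_linear_form_continuous : continuous L.
Proof.
have @LL : {linear 'M[R]_(m, n) -> R} :=
  HB.pack L (GRing.isLinear.Build _ _ _ _ L linL).
move=> A; apply: differentiable_continuous.
(* A linear form is a finite combination of coordinate maps. *)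
have -> : L = \sum_i \sum_j (fun A : 'M[R]_(m, n) =>
    A i j * L (delta_mx i j)).
  apply/funext => B; rewrite -[L B]/(LL B) {1}(matrix_sum_delta B) linear_sum
    fct_sumE.
  apply: eq_bigr => i _; rewrite linear_sum fct_sumE.
  by apply: eq_bigr => j _; rewrite linearZ.
apply: differentiable_sum => i; apply: differentiable_sum => j.
apply: differentiableM; first exact: differentiable_coord.
exact: differentiable_cst.
Qed.

Lemma differentiable_mx_linear_form (V : normedModType R)
    (A : V -> 'M[R]_(m, n)) (x : V) :
  differentiable A x -> differentiable (L \o A) x.
Proof.
have @LL : {linear 'M[R]_(m, n) -> R} :=
  HB.pack L (GRing.isLinear.Build _ _ _ _ L linL).
move=> dA; apply: differentiable_comp => //.
exact: (@linear_differentiable _ _ _ LL _ (@mx_linear_form_continuous)).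
Qed.

Lemma derive_mx_linear_form (V : normedModType R)
    (A : V -> 'M[R]_(m, n)) (x w : V) :
  differentiable A x -> 'D_w (L \o A) x = L ('d A x w).
Proof.
have @LL : {linear 'M[R]_(m, n) -> R} :=
  HB.pack L (GRing.isLinear.Build _ _ _ _ L linL).
move=> dA.
have dL : differentiable L (A x).
  exact: (@linear_differentiable _ _ _ LL _ (@mx_linear_form_continuous)).
rewrite deriveE; last exact: differentiable_mx_linear_form.
by rewrite diff_comp//= (diff_lin (f := LL))//;
  exact: mx_linear_form_continuous.
Qed.

End LinearForms.

Lemma dotvC (R : realType) m (u v : 'cV[R]_m) : dotv u v = dotv v u.
Proof. by rewrite /dotv !mxE; apply: eq_bigr => i _; rewrite !mxE mulrC. Qed.

Lemma dotv_linearl (R : realType) m (a : R) (u u' v : 'cV[R]_m) :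
  dotv (a *: u + u') v = a * dotv u v + dotv u' v.
Proof. by rewrite /dotv linearD linearZ mulmxDl -scalemxAl !mxE. Qed.

Lemma dotv_linearr (R : realType) m (u : 'cV[R]_m) (a : R) (v v' : 'cV[R]_m) :
  dotv u (a *: v + v') = a * dotv u v + dotv u v'.
Proof. by rewrite dotvC dotv_linearl !(dotvC _ u). Qed.

Lemma dotv_mulmx (R : realType) m n (u : 'cV[R]_m) (A : 'M[R]_(m, n))
    (v : 'cV[R]_n) : dotv u (A *m v) = dotv (A^T *m u) v.
Proof. by rewrite /dotv trmx_mul trmxK mulmxA. Qed.

Lemma cV_sum_delta (R : realType) m (u : 'cV[R]_m) :
  u = \sum_i u i 0 *: delta_mx i 0.
Proof.
by rewrite {1}[u]matrix_sum_delta; apply: eq_bigr => i _; rewrite big_ord1.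
Qed.

(** * Derivatives of [f] up to order three as symmetric forms *)

Section ThirdDerivative.
Variables (R : realType) (N : nat) (f : 'cV[R]_N -> R).
Hypothesis f_diff3 : three_times_differentiable f.
Implicit Types x u v w : 'cV[R]_N.

Let f_diff x : differentiable f x. Proof. by have [] := f_diff3 x. Qed.
Let grad_diff x : differentiable (grad f) x. Proof. by have [] := f_diff3 x.
  Qed.
Let hess_diff x : differentiable (hess f) x. Proof. by have [] := f_diff3 x.
  Qed.

Lemma derive_grad u : 'D_u f = (dotv u) \o (grad f).
Proof.
apply/funext => x; rewrite deriveE// {1}[u]cV_sum_delta linear_sum /=.
rewrite /dotv mxE; apply: eq_bigr => i _.
by rewrite linearZ !mxE deriveE.
Qed.

Lemma diff_grad x v : 'd (grad f) x v = hess f x *m v.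
Proof.
rewrite {1}[v]cV_sum_delta linear_sum /=; apply/colP => i.
rewrite summxE mxE; apply: eq_bigr => j _.
rewrite linearZ !mxE mulrC; congr (_ * _).
have -> : (fun y => 'D_(delta_mx i 0) f y) = dotv (delta_mx i 0) \o grad f.
  exact: derive_grad.
rewrite derive_mx_linear_form//; first by rewrite /dotv trmx_delta -rowE mxE.
exact: dotv_linearr.
Qed.

Lemma differentiable_derive u x : differentiable ('D_u f) x.
Proof.
rewrite derive_grad; apply: differentiable_mx_linear_form => //.
exact: dotv_linearr.
Qed.

Lemma derive_derive u v : 'D_v ('D_u f) = fun x => dotv u (hess f x *m v).
Proof.
apply/funext => x; rewrite derive_grad derive_mx_linear_form ?diff_grad//.
exact: dotv_linearr.
Qed.

Lemma hess_sym x u v : dotv u (hess f x *m v) = dotv v (hess f x *m u).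
Proof.
have E a b : dotv a (hess f x *m b) = 'D_b ('D_a f) x.
  by rewrite -[RHS]/(('D_b ('D_a f)) x) derive_derive.
by rewrite !E; apply: derive_comm => //; exact: differentiable_derive.
Qed.

Let form_linear u v a (A B : 'M[R]_N) :
  dotv u ((a *: A + B) *m v) = a * dotv u (A *m v) + dotv u (B *m v).
Proof. by rewrite mulmxDl -scalemxAl dotv_linearr. Qed.

(** The third derivative [D^3 f(x)[u, v, w]]; the last argument is the direction in which the
    Hessian is differentiated. *)
Definition third_form x u v w : R := dotv u ('d (hess f) x w *m v).

Lemma derive_hess u v w x :
  'D_w (fun y => dotv u (hess f y *m v)) x = third_form x u v w.
Proof.
exact: (derive_mx_linear_form (L := fun A => dotv u (A *m v)) (form_linear u
  v)).
Qed.

Lemma differentiable_hess_form u v x :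
  differentiable (fun y => dotv u (hess f y *m v)) x.
Proof.
exact: (differentiable_mx_linear_form
  (L := fun A => dotv u (A *m v)) (form_linear u v)).
Qed.

Lemma third_formC12 x u v w : third_form x u v w = third_form x v u w.
Proof.
suff E : (fun y => dotv u (hess f y *m v)) = (fun y => dotv v (hess f y *m u)).
  by rewrite -!derive_hess E.
by apply/funext => y; exact: hess_sym.
Qed.

(** Symmetry of second derivatives, applied to ['D_u f] in place of [f]. Together with
    [third_formC12] it makes the form fully symmetric. *)
Lemma third_formC23 x u v w : third_form x u v w = third_form x u w v.
Proof.
rewrite -!derive_hess -!derive_derive; apply: derive_comm.
- exact: differentiable_derive.
- by rewrite derive_derive; exact: differentiable_hess_form.
- by rewrite derive_derive; exact: differentiable_hess_form.
Qed.

Lemma third_form_linear x a u u' v w :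
  third_form x (a *: u + u') v w = a * third_form x u v w + third_form x u' v w.
Proof. exact: dotv_linearl. Qed.

Lemma is_derive_hess_line x d u v (s : R) :
  is_derive s 1 (fun s => dotv u (hess f (x + s *: d) *m v))
    (third_form (x + s *: d) u v d).
Proof.
rewrite -derive_hess.
exact/(is_derive_line (g := fun y => dotv u (hess f y *m
  v)))/differentiable_hess_form.
Qed.

Lemma is_derive_grad_line x d u (s : R) :
  is_derive s 1 (fun s => dotv u (grad f (x + s *: d)))
    (dotv u (hess f (x + s *: d) *m d)).
Proof.
rewrite -[dotv u (hess _ _ *m _)]/((fun y => dotv u (hess f y *m d)) _).
rewrite -derive_derive derive_grad.
apply: (is_derive_line (g := dotv u \o grad f)).
by rewrite -derive_grad; exact: differentiable_derive.
Qed.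

Lemma is_derive_fun_line x d (s : R) :
  is_derive s 1 (fun s => f (x + s *: d)) (dotv d (grad f (x + s *: d))).
Proof.
rewrite -[dotv d _]/((dotv d \o grad f) _) -derive_grad.
exact: (is_derive_line (g := f)).
Qed.

Lemma derive1n2_line x u (s : R) :
  derive1n 2 (fun s => f (x + s *: u)) s = dotv u (hess f (x + s *: u) *m u).
Proof.
rewrite derive1nS derive1n1.
rewrite (_ : derive1 (fun s => f (x + s *: u)) =
  fun s => dotv u (grad f (x + s *: u))).
  by rewrite derive1E; apply/derive_val/is_derive_grad_line.
by apply/funext => y; rewrite derive1E; apply/derive_val/is_derive_fun_line.
Qed.

Lemma derive1n3_line x u (s : R) :
  derive1n 3 (fun s => f (x + s *: u)) s = third_form (x + s *: u) u u u.
Proof.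
rewrite derive1nS (_ : derive1n 2 _ = fun s => dotv u (hess f (x + s *: u)
  *m u)).
  by rewrite derive1E; apply/derive_val/is_derive_hess_line.
by apply/funext => y; exact: derive1n2_line.
Qed.

End ThirdDerivative.

(** * Self-concordant functions *)

Definition local_norm (R : realType) (N : nat) (f : 'cV[R]_N -> R)
  (x u : 'cV[R]_N) : R := Num.sqrt (dotv u (hess f x *m u)).

Section SelfConcordance.
Variables (R : realType) (N : nat) (f : 'cV[R]_N -> R).
Hypothesis f_sc : self_concordant f.
Hypothesis f_strict : forall x, positive_definite (hess f x).
Implicit Types x u v w d : 'cV[R]_N.

Let f_diff3 : three_times_differentiable f. Proof. by case: f_sc. Qed.

Let form_linear x a u u' v : dotv (a *: u + u') (hess f x *m v) =
  a * dotv u (hess f x *m v) + dotv u' (hess f x *m v).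
Proof. exact: dotv_linearl. Qed.

Lemma hess_form_ge0 x u : 0 <= dotv u (hess f x *m u).
Proof.
exact: (form_ge0 (B := fun u v => dotv u (hess f x *m v)) (form_linear x)
  (f_strict x)).
Qed.

Lemma local_norm_ge0 x u : 0 <= local_norm f x u.
Proof. exact: sqrtr_ge0. Qed.

Lemma local_norm_gt0 x u : u != 0 -> 0 < local_norm f x u.
Proof. by move=> u0; rewrite sqrtr_gt0 f_strict. Qed.

Lemma sqr_local_norm x u : local_norm f x u ^+ 2 = dotv u (hess f x *m u).
Proof. by rewrite sqr_sqrtr// hess_form_ge0. Qed.

Lemma hess_Cauchy_Schwarz x u v :
  dotv u (hess f x *m v) <= local_norm f x u * local_norm f x v.
Proof.
exact: (form_Cauchy_Schwarz (B := fun u v => dotv u (hess f x *m v))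
  (form_linear x) (hess_sym f_diff3 x) (f_strict x)).
Qed.

(** Banach's theorem with [M = 2]: if [w] has local norm at most 1, self-concordance along [w] at
    parameter 0 bounds the diagonal by [2 * 1^(3/2)]. *)
Lemma third_form_bound x u v :
  `|third_form f x u v v| <= 2 * local_norm f x u * local_norm f x v ^+ 2.
Proof.
rewrite sqr_local_norm.
apply: (symmetric_trilinear_bound (B := fun u v => dotv u (hess f x *m v))
  (form_linear x) (hess_sym f_diff3 x) (f_strict x)
  (third_form_linear f x) (third_formC12 f_diff3 x) (third_formC23 f_diff3 x)).
move=> w w1; have [_ _ /(_ x w 0) h] := f_sc.
have {}h : `|derive1n 3 (fun s => f (x + s *: w)) 0| <=
  2 * (derive1n 2 (fun s => f (x + s *: w)) 0) `^ (3 / 2) by exact: h.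
move: h; rewrite (derive1n3_line f_diff3) (derive1n2_line f_diff3) scale0r
  addr0.
move=> /le_trans; apply; rewrite ler_piMr//.
have one : 1 `^ (3 / 2) = 1 :> R by rewrite powR1.
rewrite -[leRHS]one.
by apply: ge0_ler_powR; rewrite ?divr_ge0 ?nnegrE ?hess_form_ge0.
Qed.

Let sqr_le_mul (u v A B k : R) : u ^+ 2 = A -> v ^+ 2 = B -> 0 <= v -> 0 <= k ->
  A <= B * k ^+ 2 -> u <= v * k.
Proof.
move=> <- <- v0 k0; rewrite -exprMn => h; rewrite leNgt; apply/negP => uvk.
have vk0 : 0 <= v * k by rewrite mulr_ge0.
have := ltr_pXn2r (n := 2) isT vk0 (le_trans vk0 (ltW uvk)).
by rewrite uvk ltNge h.
Qed.

Let sqr_mul_le (u v A B k : R) : u ^+ 2 = A -> v ^+ 2 = B -> 0 <= u ->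
  B * k ^+ 2 <= A -> v * k <= u.
Proof.
move=> <- <- u0; rewrite -exprMn => h; rewrite leNgt; apply/negP => uvk.
have := ltr_pXn2r (n := 2) isT u0 (le_trans u0 (ltW uvk)).
by rewrite uvk ltNge h.
Qed.

Section Line.
Variables (x d : 'cV[R]_N) (r b : R).
Hypotheses (d0 : d != 0) (rE : local_norm f x d = r).
Hypotheses (b0 : 0 <= b) (br1 : b * r < 1).

Let r0 : 0 < r. Proof. by rewrite -rE local_norm_gt0. Qed.

Let rb (s : R) : 0 <= s <= b -> 0 < 1 - s * r.
Proof.
case/andP=> s0 sb; rewrite subr_gt0; apply: le_lt_trans br1.
by apply: ler_wpM2r => //; exact: ltW.
Qed.

Let line0 : x + 0 *: d = x. Proof. by rewrite scale0r addr0. Qed.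

Let k_ge0 (s : R) : 0 <= s <= b -> 0 <= (1 - s * r)^-1.
Proof. by move=> /rb s0; rewrite invr_ge0 ltW. Qed.

(** The function [rho s = |d|_(x + s d)] has derivative [D^3 f[d,d,d] / (2 rho)], at most [rho^2],
    so the Riccati comparison applies. *)
Lemma local_norm_direction (s : R) : 0 <= s <= b ->
  local_norm f (x + s *: d) d <= r * (1 - s * r)^-1.
Proof.
pose q (s : R) : R := dotv d (hess f (x + s *: d) *m d).
have dq (y : R) : is_derive y 1 q (third_form f (x + y *: d) d d d).
  exact: is_derive_hess_line.
have dsqrt (y : R) := is_derive1_sqrt (f_strict (x + y *: d) d0).
have drho (y : R) := is_derive1_comp (dsqrt y) (dq y).
move=> sb; apply: (riccati_upper rb (fun y _ => drho y) sb).
- by rewrite /= /q scale0r addr0 -/(local_norm f x d).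
- by move=> y _; exact: local_norm_gt0.
- move=> y _; have := third_form_bound (x + y *: d) d d.
  move=> /(le_trans (ler_norm _));
    rewrite /= /q -/(local_norm f (x + y *: d) d).
  have := local_norm_gt0 (x + y *: d) d0.
  move: (local_norm _ _ _) (third_form _ _ _ _ _) => a T a0 Ta.
  by rewrite ler_pdivrMl ?mulr_gt0.
Qed.

Let third_form_line v (s : R) : 0 <= s <= b ->
  `|third_form f (x + s *: d) v v d| <=
    2 * (r * (1 - s * r)^-1) * dotv v (hess f (x + s *: d) *m v).
Proof.
move=> sb; rewrite (third_formC23 f_diff3) (third_formC12 f_diff3).
apply: le_trans (third_form_bound _ _ _) _; rewrite sqr_local_norm.
apply: ler_wpM2r; first exact: hess_form_ge0.
by apply: ler_wpM2l => //; exact: local_norm_direction.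
Qed.

(** Along the line, [|v|^2] has derivative [D^3 f[v,v,d]], of absolute value at most [2 |d| |v|^2],
    where [|d|] is controlled by [local_norm_direction]; Gronwall's inequality then compares the
    endpoints. *)
Lemma local_norm_upper v (s : R) : 0 <= s <= b ->
  local_norm f (x + s *: d) v <= local_norm f x v * (1 - s * r)^-1.
Proof.
move=> sb.
have h : dotv v (hess f (x + s *: d) *m v) * (1 - s * r) ^+ 2 <=
    dotv v (hess f x *m v).
  rewrite -[in leRHS]line0.
  exact: (gronwall_upper rb (fun y _ => is_derive_hess_line f_diff3 x d v v y)
    sb (fun y yb => le_trans (ler_norm _) (third_form_line v yb))).
rewrite ler_pdivlMr; last exact: rb.
exact: (sqr_mul_le (sqr_local_norm _ v) (sqr_local_norm _ v)
  (local_norm_ge0 _ v) h).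
Qed.

Lemma local_norm_lower v (s : R) : 0 <= s <= b ->
  local_norm f x v <= local_norm f (x + s *: d) v * (1 - s * r)^-1.
Proof.
move=> sb; have T_ge (y : R) (yb : 0 <= y <= b) :=
  proj1 (andP (etrans (esym (ler_norml _ _)) (third_form_line v yb))).
have h : dotv v (hess f x *m v) <=
    dotv v (hess f (x + s *: d) *m v) * (1 - s * r)^-1 ^+ 2.
  rewrite -[in leLHS]line0.
  exact: (gronwall_lower rb
    (fun y _ => is_derive_hess_line f_diff3 x d v v y) sb T_ge).
exact: (sqr_le_mul (sqr_local_norm _ v) (sqr_local_norm _ v)
  (local_norm_ge0 _ v) (k_ge0 sb) h).
Qed.

(** The curvature [|d|^2] along the segment is replaced by the largest value of its bound, reached
    at the end [b]. *)
Lemma function_upper_bound :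
  f (x + b *: d) <=
    f x + b * dotv d (grad f x) + (r * (1 - b * r)^-1) ^+ 2 * b ^+ 2 / 2.
Proof.
suff h y : 0 <= y <= b ->
    dotv d (hess f (x + y *: d) *m d) <= (r * (1 - b * r)^-1) ^+ 2.
  rewrite -[in leRHS]line0.
  exact: (second_order_bound b0 (fun y _ => is_derive_fun_line f_diff3 x d y)
    (fun y _ => is_derive_grad_line f_diff3 x d d y) h).
move=> yb.
rewrite -sqr_local_norm; apply: lerXn2r; rewrite ?nnegrE ?local_norm_ge0//.
  by rewrite mulr_ge0 ?(ltW r0)// k_ge0// b0 lexx.
apply: le_trans (local_norm_direction yb) _.
apply: ler_wpM2l; first exact: ltW.
rewrite lef_pV2 ?posrE ?rb ?b0 ?lexx// lerD2l lerN2 ler_wpM2r ?(ltW r0)//.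
by case/andP: yb.
Qed.

(** Tested against [v], the gradient along the line has second derivative [D^3 f[v,d,d]], at most
    [2 |v| |d|^2]; both norms are carried back to [x], which gives the shape required by
    [second_order_remainder]. *)
Lemma gradient_remainder_bound v :
  dotv v (grad f (x + b *: d)) - dotv v (grad f x) - b * dotv v (hess f x *m d)
  <= local_norm f x v * ((1 - b * r)^-1 - 1 - b * r).
Proof.
suff h y : 0 <= y <= b -> third_form f (x + y *: d) v d d <=
    2 * (local_norm f x v * (1 - y * r)^-1) * (r * (1 - y * r)^-1) ^+ 2.
  have rem := second_order_remainder b0 rb
    (fun y _ => is_derive_grad_line f_diff3 x d v y)
    (fun y _ => is_derive_hess_line f_diff3 x d v d y) h.
  move: rem; set x0 := x + 0 *: d.
  by have -> : x0 = x by exact: line0.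
move=> yb.
apply: le_trans (ler_norm _) _; apply: le_trans (third_form_bound _ _ _) _.
have ky := k_ge0 yb.
apply: ler_pM; rewrite ?sqr_ge0 ?mulr_ge0 ?local_norm_ge0//.
  by apply: ler_wpM2l => //; exact: local_norm_upper.
rewrite ler_sqr ?nnegrE ?local_norm_ge0//; last by rewrite mulr_ge0// ltW.
exact: local_norm_direction.
Qed.

End Line.
End SelfConcordance.

(** * The two directions of SIGMA *)

Lemma posdef_unitmx (R : realType) (N : nat) (A : 'M[R]_N) :
  positive_definite A -> A \in unitmx.
Proof.
move=> A0; rewrite -row_free_unit; apply: inj_row_free => v vA.
apply: trmx_inj; apply/eqP; rewrite trmx0; apply: contraT => /A0.
by rewrite /dotv trmxK mulmxA vA mul0mx mxE ltxx.
Qed.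

Lemma dotvN (R : realType) m (u v : 'cV[R]_m) : dotv u (- v) = - dotv u v.
Proof. by rewrite /dotv mulmxN mxE. Qed.

Lemma dotvD (R : realType) m (u v w : 'cV[R]_m) :
  dotv u (v + w) = dotv u v + dotv u w.
Proof. by rewrite /dotv mulmxDr mxE. Qed.

(** Here [l] is the new decrement, [E] the dual norm of the residual at [x], and [V] the norm at [x]
    of a vector [v] whose product with the new gradient is [l^2]; [a] and [b] are the products of
    [v] with the old gradient and with [H d]. Adding the bounds gives
    [l^2 <= V (E + r^2 / (1 - r))]; then [V] is bounded through [l] and one factor [l] cancels. *)
Lemma decrement_arith (R : realType) (r E V l a b : R) : r < 1 ->
  0 <= E -> 0 <= l -> a + b <= V * E -> V <= l * (1 - r)^-1 ->
  l ^+ 2 - a - b <= V * ((1 - r)^-1 - 1 - r) ->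
  l <= (E + r ^+ 2 / (1 - r)) / (1 - r).
Proof.
move=> r1 E0 l0 h1 h2 h3.
have r1' : 0 < 1 - r by rewrite subr_gt0.
have c0 : 0 <= r ^+ 2 / (1 - r) by rewrite divr_ge0 ?sqr_ge0// ltW.
have cE : (1 - r)^-1 - 1 - r = r ^+ 2 / (1 - r) by field; rewrite gt_eqF.
have l2 : l * l <= l * ((E + r ^+ 2 / (1 - r)) / (1 - r)).
  have := ler_wpM2r (addr_ge0 E0 c0) h2; rewrite cE in h3.
  move: (r ^+ 2 / (1 - r)) ((1 - r)^-1) h3 => c i h3; lra.
have [l00|lN0] := eqVneq l 0;
  first by rewrite l00 divr_ge0 ?(ltW r1')// addr_ge0.
by rewrite ler_pM2l ?lt_def ?lN0 in l2.
Qed.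

(** After cancellation this is the hypothesis [t / (1 - t r)^2 <= 2 (1 - alpha)] multiplied by
    [t r^2 / 2]. *)
Lemma armijo_arith (R : realType) (F r alpha t : R) : 0 <= t -> t * r < 1 ->
  t <= 2 * (1 - alpha) * (1 - t * r) ^+ 2 ->
  F + t * - r ^+ 2 + (r * (1 - t * r)^-1) ^+ 2 * t ^+ 2 / 2 <=
  F + alpha * t * - r ^+ 2.
Proof.
move=> t0 tr1 ht; have u0 : 0 < 1 - t * r by rewrite subr_gt0.
have u2 : 0 < (1 - t * r) ^+ 2 by rewrite exprn_gt0.
have {}ht : t * (1 - t * r)^-1 ^+ 2 <= 2 * (1 - alpha).
  by rewrite exprVn ler_pdivrMr.
have rt : 0 <= t * r ^+ 2 by rewrite mulr_ge0// sqr_ge0.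
have := ler_wpM2l rt ht; move: (1 - t * r)^-1 => i; lra.
Qed.

(** The guaranteed decrease is [alpha beta / 4] times [r^2 / (1 + r)], which increases with [r];
    this makes it uniform over [r > m]. *)
Lemma decrease_arith (R : realType) (F F1 alpha beta m r t : R) :
  0 < alpha -> 0 < beta -> 0 < m -> m < r ->
  beta / (4 * (1 + r)) <= t -> F1 <= F + alpha * t * - r ^+ 2 ->
  F1 - F <= - (alpha * beta * m ^+ 2 / (4 * (1 + m))).
Proof.
move=> a0 b0 m0 mr tb h; have r0 : 0 < r by exact: lt_trans mr.
have ar : 0 <= alpha * r ^+ 2 by rewrite mulr_ge0 ?sqr_ge0// ltW.
have h1 := ler_wpM2l ar tb.
suff : alpha * beta * m ^+ 2 / (4 * (1 + m)) <=
    alpha * r ^+ 2 * (beta / (4 * (1 + r))) by lra.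
have -> : alpha * r ^+ 2 * (beta / (4 * (1 + r))) =
    alpha * beta * r ^+ 2 / (4 * (1 + r)) by field; lra.
rewrite ler_pdivrMr ?mulr_gt0 ?addr_gt0//.
rewrite [leRHS]mulrAC ler_pdivlMr ?mulr_gt0 ?addr_gt0// -!mulrA.
do 2!(apply: ler_wpM2l; first exact: ltW).
suff : m ^+ 2 * (1 + r) <= r ^+ 2 * (1 + m) by lra.
have : 0 <= (r - m) * (r + m + m * r).
  have := mulr_gt0 m0 r0; move=> mr0; apply: mulr_ge0; lra.
lra.
Qed.

Section Directions.
Variables (R : realType) (N : nat) (f : 'cV[R]_N -> R).
Hypothesis f_sc : self_concordant f.
Hypothesis f_strict : forall x, positive_definite (hess f x).
Implicit Types x u v w d : 'cV[R]_N.

Let f_diff3 : three_times_differentiable f. Proof. by case: f_sc. Qed.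

Let hessK x v : hess f x *m (invmx (hess f x) *m v) = v.
Proof. by rewrite mulKVmx// posdef_unitmx. Qed.

Let hessVK x v : invmx (hess f x) *m (hess f x *m v) = v.
Proof. by rewrite mulKmx// posdef_unitmx. Qed.

Lemma local_norm_invmx x v : local_norm f x (invmx (hess f x) *m v) =
  Num.sqrt (dotv v (invmx (hess f x) *m v)).
Proof. by rewrite /local_norm hessK dotvC. Qed.

Lemma dual_norm_bound x u v :
  dotv u v <= local_norm f x u * Num.sqrt (dotv v (invmx (hess f x) *m v)).
Proof.
rewrite -local_norm_invmx -[in leLHS](hessK x v).
exact: hess_Cauchy_Schwarz.
Qed.

Lemma sqr_newton_decr x :
  newton_decr f x ^+ 2 = dotv (grad f x) (invmx (hess f x) *m grad f x).
Proof.
by rewrite /newton_decr -local_norm_invmx sqr_local_norm// hessK dotvC.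
Qed.

Lemma newton_decr_ge0 x : 0 <= newton_decr f x.
Proof. exact: sqrtr_ge0. Qed.

Lemma dotv_newton_dir x :
  dotv (grad f x) (newton_dir f x) = - newton_decr f x ^+ 2.
Proof. by rewrite sqr_newton_decr dotvN. Qed.

Lemma local_norm_newton_dir x : local_norm f x (newton_dir f x) = newton_decr f
  x.
Proof.
rewrite /local_norm /newton_dir mulmxN dotvN dotvC dotvN opprK hessK.
by rewrite /newton_decr.
Qed.

(** * Steps along a direction whose slope is minus its squared local norm *)

Section Direction.
Variables (x d : 'cV[R]_N) (r : R).
Hypotheses (r0 : 0 < r) (d_norm : local_norm f x d = r)
  (d_grad : dotv (grad f x) d = - r ^+ 2).

Let d0 : d != 0.
Proof.
apply: contraTneq r0 => d0.
by rewrite -d_norm d0 /local_norm mulmx0 /dotv mulmx0 mxE sqrtr0 ltxx.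
Qed.

(** Expanding the square gives [lambda^2 + 2 <grad f, d> + |d|^2], that is
    [lambda^2 - 2 r^2 + r^2]. *)
Lemma dual_norm_residual :
  dotv (grad f x + hess f x *m d)
    (invmx (hess f x) *m (grad f x + hess f x *m d)) =
  newton_decr f x ^+ 2 - r ^+ 2.
Proof.
have dd : dotv d (hess f x *m d) = r ^+ 2 by rewrite -d_norm sqr_local_norm.
rewrite mulmxDr hessVK dotvD !(dotvC (grad f x + _)) !dotvD.
rewrite -(hess_sym f_diff3) hessK dd !(dotvC _ (grad f x)) d_grad.
by rewrite sqr_newton_decr; ring.
Qed.

(** The squared dual norm of the residual, [lambda^2 - r^2], is nonnegative. *)
Lemma direction_norm_le : r <= newton_decr f x.
Proof.
have := sqr_ge0 (local_norm f x
  (invmx (hess f x) *m (grad f x + hess f x *m d))).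
rewrite sqr_local_norm// hessK dotvC dual_norm_residual subr_ge0.
by rewrite ler_sqr// nnegrE ?newton_decr_ge0// ltW.
Qed.

Lemma newton_decr_step : r < 1 ->
  newton_decr f (x + d) <=
  (Num.sqrt (newton_decr f x ^+ 2 - r ^+ 2) + r ^+ 2 / (1 - r)) / (1 - r).
Proof.
move=> r1.
have one01 := introT andP (conj (@ler01 R) (lexx (1 : R))).
have br1 : 1 * r < 1 by rewrite mul1r.
(* This [v] attains the dual norm of the new gradient: its local norm at [x + d] is the new
   decrement, and its product with the new gradient is the square of that decrement. *)
pose v := invmx (hess f (x + d)) *m grad f (x + d).
have vN : local_norm f (x + d) v = newton_decr f (x + d).
  exact: local_norm_invmx.
have vv : newton_decr f (x + d) ^+ 2 = dotv v (grad f (x + d)).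
  by rewrite sqr_newton_decr dotvC.
have xd : x + 1 *: d = x + d by rewrite scale1r.
have h3 := gradient_remainder_bound f_sc f_strict d0 d_norm ler01 br1 v.
have h2 := local_norm_lower f_sc f_strict d0 d_norm br1 v one01.
rewrite xd !mul1r -vv in h3; rewrite xd vN mul1r in h2.
have h1 := dual_norm_bound x v (grad f x + hess f x *m d).
rewrite dual_norm_residual dotvD in h1.
exact: (decrement_arith r1 (sqrtr_ge0 _) (newton_decr_ge0 _) h1 h2 h3).
Qed.

Lemma sufficient_decrease_small (alpha t : R) : 0 <= t -> t * r < 1 ->
  t <= 2 * (1 - alpha) * (1 - t * r) ^+ 2 -> sufficient_decrease f alpha x d t.
Proof.
move=> t0 tr1 ht; rewrite /sufficient_decrease.
have h := function_upper_bound f_sc f_strict d0 d_norm t0 tr1.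
rewrite dotvC d_grad in h; rewrite d_grad.
exact: le_trans h (armijo_arith _ t0 tr1 ht).
Qed.

Lemma backtracking_unit_step (alpha beta t : R) : 0 < alpha < 1 / 2 ->
  r <= (1 - 2 * alpha) / 4 -> backtracking_step f alpha beta x d t -> t = 1.
Proof.
move=> /andP[a0 a2] ra [[|m] [-> _ h]]; first by rewrite expr0.
have /negP[] := h 0%N isT; rewrite expr0.
(* With [c = 1 - 2 alpha] in [(0, 1)] and [r <= c / 4], one has [2 (1 - alpha) (1 - r)^2 >= (1 + c)
   (1 - c / 2) >= 1], so the first trial already succeeds. *)
apply: sufficient_decrease_small; rewrite ?ler01// mul1r; first by lra.
by nra.
Qed.

Lemma backtracking_decrease (alpha beta t m : R) :
  0 < alpha < 1 / 2 -> 0 < beta < 1 -> 0 < m < r ->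
  backtracking_step f alpha beta x d t ->
  f (x + t *: d) - f x <= - (alpha * beta * m ^+ 2 / (4 * (1 + m))).
Proof.
move=> /andP[a0 a2] /andP[b0 b1] /andP[m0 mr] [k [-> suff_k fail]].
(* Either the unit step was accepted, or the trial just before the accepted one failed. A trial
   [t < 1 / (4 (1 + r))] cannot fail: then [t r < 1 / 4], so
   [2 (1 - alpha) (1 - t r)^2 > 9 / 16 > t]. *)
have tb : beta / (4 * (1 + r)) <= beta ^+ k.
  case: k suff_k fail => [_ _|k _ /(_ k (ltnSn k)) fail].
    by rewrite expr0 ler_pdivrMr ?mul1r; lra.
  rewrite exprS ler_wpM2l ?(ltW b0)// leNgt; apply: contra fail => bk.
  have bk0 : 0 < beta ^+ k by rewrite exprn_gt0.
  have {}bk : beta ^+ k * (4 * (1 + r)) < 1.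
    by rewrite -ltr_pdivlMr ?mul1r ?div1r//; lra.
  have bkr : 0 < beta ^+ k * r by rewrite mulr_gt0.
  apply: sufficient_decrease_small; [exact: ltW|lra|nra].
move: suff_k; rewrite /sufficient_decrease d_grad => h.
exact: decrease_arith h.
Qed.

End Direction.
End Directions.

(** * The coarse direction as a Newton step restricted to the range of [P] *)

Section CoarseDirection.
Variables (R : realType) (N n : nat) (f : 'cV[R]_N -> R) (P : 'M[R]_(N, n)).
Hypothesis f_sc : self_concordant f.
Hypothesis f_strict : forall x, positive_definite (hess f x).
Hypothesis rankP : \rank P = n.

(** Full column rank makes [P] injective, so the form of the Hessian stays definite when pulled
    back. *)
Lemma reduced_hess_posdef x : positive_definite (reduced_hess f P x).
Proof.
move=> v v0; rewrite /reduced_hess -!mulmxA dotv_mulmx trmxK; apply: f_strict.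
apply: contraNneq v0 => Pv0; apply/eqP/trmx_inj/eqP; rewrite trmx0.
have freeP : row_free P^T by rewrite -row_leq_rank mxrank_tr rankP.
by rewrite -(mulmx_free_eq0 _ freeP) -trmx_mul Pv0 trmx0.
Qed.

Let y x := invmx (reduced_hess f P x) *m reduced_grad f P x.

Let yE x : dotv (P *m y x) (hess f x *m (P *m y x)) =
  dotv (reduced_grad f P x) (y x).
Proof.
rewrite dotvC dotv_mulmx; congr (dotv _ _).
rewrite mulmxA mulmxA -/(reduced_hess f P x) mulKVmx// posdef_unitmx//.
exact: reduced_hess_posdef.
Qed.

Lemma local_norm_coarse_dir x :
  local_norm f x (coarse_dir f P x) = approx_decr f P x.
Proof.
rewrite /local_norm /coarse_dir mulmxN dotvN dotvC dotvN opprK dotvC.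
by rewrite -/(y x) yE.
Qed.

Lemma dotv_coarse_dir x :
  dotv (grad f x) (coarse_dir f P x) = - approx_decr f P x ^+ 2.
Proof.
rewrite -local_norm_coarse_dir sqr_local_norm//.
rewrite /coarse_dir -/(y x) mulmxN !dotvN (dotvC (- _)) dotvN opprK.
by rewrite (dotvC (hess f x *m _)) yE dotv_mulmx.
Qed.

End CoarseDirection.

(** * Contraction of the decrement and choice of the constants *)

(** From [mu l < r] the square root is at most [eps l]; every other occurrence of [r] is replaced by
    the larger [l]. The resulting numerator [eps (1 - l) + l] is finally relaxed to [eps + l]. *)
Lemma coarse_contraction (R : realType) (mu r l : R) : 0 < mu < 1 ->
  0 < r -> r <= l -> l < 1 -> mu * l < r ->
  (Num.sqrt (l ^+ 2 - r ^+ 2) + r ^+ 2 / (1 - r)) / (1 - r) <=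
  (Num.sqrt (1 - mu ^+ 2) + l) / (1 - l) ^+ 2 * l.
Proof.
move=> /andP[mu0 mu1] r0 rl l1 mur.
have l0 : 0 < l by exact: lt_le_trans rl.
have u0 : 0 < 1 - l by rewrite subr_gt0.
have ur : 1 - l <= 1 - r by rewrite lerD2l lerN2.
have v0 : 0 < 1 - r by exact: lt_le_trans ur.
have iur : (1 - r)^-1 <= (1 - l)^-1 by rewrite lef_pV2.
have i0 : 0 <= (1 - r)^-1 by rewrite invr_ge0 ltW.
have e0 := sqrtr_ge0 (1 - mu ^+ 2).
have h1 : Num.sqrt (l ^+ 2 - r ^+ 2) <= Num.sqrt (1 - mu ^+ 2) * l.
  rewrite -[X in _ * X](gtr0_norm l0) -sqrtr_sqr -sqrtrM; last by nra.
  rewrite ler_wsqrtr// mulrBl mul1r lerD2l lerN2 -exprMn ler_sqr ?nnegrE ?ltW//.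
  by rewrite mulr_gt0.
have h2 : r ^+ 2 / (1 - r) <= l ^+ 2 / (1 - l).
  apply: ler_pM => //; first exact: sqr_ge0.
  by rewrite ler_sqr ?nnegrE ?(ltW r0) ?(ltW l0).
have h3 : (Num.sqrt (l ^+ 2 - r ^+ 2) + r ^+ 2 / (1 - r)) / (1 - r) <=
    (Num.sqrt (1 - mu ^+ 2) * l + l ^+ 2 / (1 - l)) / (1 - l).
  apply: ler_pM => //; last exact: lerD.
  by rewrite addr_ge0 ?sqrtr_ge0// mulr_ge0// sqr_ge0.
apply: le_trans h3 _.
have -> : (Num.sqrt (1 - mu ^+ 2) * l + l ^+ 2 / (1 - l)) / (1 - l) =
    (Num.sqrt (1 - mu ^+ 2) * (1 - l) + l) / (1 - l) ^+ 2 * l.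
  by field; rewrite gt_eqF.
rewrite ler_wpM2r ?(ltW l0)// ler_wpM2r ?invr_ge0 ?sqr_ge0// lerD2r.
by rewrite ler_piMr//; lra.
Qed.

(** The threshold is chosen so that [e + l <= 1 - 2 l < (1 - l)^2]. The case [e = 0] serves the fine
    step. *)
Lemma contraction_lt (R : realType) (e l : R) : 0 <= e -> 0 < l ->
  l <= (1 - e) / 3 -> (e + l) / (1 - l) ^+ 2 * l < l.
Proof.
move=> e0 l0 le; rewrite gtr_pMl// ltr_pdivrMr ?mul1r;
  last by rewrite exprn_gt0//; lra.
by nra.
Qed.

Theorem theorem3p2 (R : realType) (N n : nat) (n_le_N : (n <= N)%N)
  (P : 'M[R]_(N, n)) (rankP : \rank P = n)
  (f : 'cV[R]_N -> R)
  (f_sc : self_concordant f)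
  (f_strict : forall x, positive_definite (hess f x))
  (f_bounded : exists m : R, forall x, m <= f x)
  (f_min : exists xmin, forall x, f xmin <= f x)
  (mu alpha beta : R)
  (mu01 : 0 < mu < 1) (alpha_bd : 0 < alpha < 1 / 2) (beta01 : 0 < beta < 1) :
  exists gammaS gammaN eta : R,
    [/\ 0 < gammaS, 0 < gammaN, 0 < eta < (3 - Num.sqrt 5) / 2 &
    forall (nu tol : R), 0 < nu < (68 / 100) ^+ 2 ->
      nu < tol < (68 / 100) ^+ 2 ->
    forall (x : nat -> 'cV[R]_N) (t : nat -> R),
      sigma_run f P mu alpha beta nu tol x t ->
    forall k : nat, sigma_performs f P mu nu tol x k ->
      let eps := Num.sqrt (1 - mu ^+ 2) in
      let lam := newton_decr f (x k) in
      let lam1 := newton_decr f (x k.+1) in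
      let coarse := coarse_taken f P mu nu (x k) in
      [/\ eta < lam -> coarse -> f (x k.+1) - f (x k) <= - gammaS,
          eta < lam -> ~~ coarse -> f (x k.+1) - f (x k) <= - gammaN,
          lam <= eta -> coarse ->
            [/\ t k = 1,
                lam1 <= (eps + lam) / (1 - lam) ^+ 2 * lam &
                (eps + lam) / (1 - lam) ^+ 2 * lam < lam] &
          lam <= eta -> ~~ coarse ->
            [/\ t k = 1,
                lam1 <= (lam / (1 - lam)) ^+ 2 &
                (lam / (1 - lam)) ^+ 2 < lam]]].
Proof.

have /andP[mu0 mu1] := mu01; have /andP[a0 a2] := alpha_bd.
have /andP[b0 b1] := beta01.
pose e : R := Num.sqrt (1 - mu ^+ 2).
have e_ge0 : 0 <= e := sqrtr_ge0 _.
have e_gt0 : 0 < e by rewrite sqrtr_gt0; nra.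
have e_lt1 : e < 1.
  by rewrite -[ltRHS]sqrtr1 ltr_sqrt//; have := exprn_gt0 2 mu0; lra.
(* The first bound makes both contraction factors less than 1, the second makes backtracking accept
   the unit step. *)
pose eta : R := Num.min ((1 - e) / 3) ((1 - 2 * alpha) / 4).
have eta0 : 0 < eta by rewrite lt_min !divr_gt0// subr_gt0//; lra.
have eta1 : eta <= (1 - e) / 3 by rewrite ge_min lexx.
have eta2 : eta <= (1 - 2 * alpha) / 4 by rewrite ge_min lexx orbT.
pose gamma (m : R) := alpha * beta * m ^+ 2 / (4 * (1 + m)).
have gamma_gt0 m : 0 < m -> 0 < gamma m.
  move=> m0; apply: divr_gt0; last by lra.
  by rewrite !mulr_gt0// exprn_gt0.
(* [gamma m] is the decrease guaranteed when the direction has norm above [m]. In the damped phase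
   this norm exceeds [mu * eta] for a coarse step, by the test for taking it, and [eta] for a fine
   one. *)
exists (gamma (mu * eta)), (gamma eta), eta; split.
- by apply: gamma_gt0; exact: mulr_gt0.
- exact: gamma_gt0.
- rewrite eta0 /=.
  (* Since [eta < 1 / 3], it suffices that [1 / 3 < (3 - sqrt 5) / 2], that is [sqrt 5 < 7 / 3]. *)
  have s5 : Num.sqrt 5 < (7 / 3 : R).
    have -> : (7 / 3 : R) = Num.sqrt (49 / 9).
      by rewrite -[LHS]ger0_norm// -sqrtr_sqr; congr Num.sqrt; field.
    by rewrite ltr_sqrt//; lra.
  lra.
move=> nu tol /andP[nu0 _] /andP[nutol _] x t run k perf eps lam lam1 coarse.
have [bt xS] := run k perf.
have lam_ge0 : 0 <= lam := sqrtr_ge0 _.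
rewrite /sigma_dir -/coarse in bt xS.
case: ifPn bt xS => [coarseT bt xS|coarseF bt xS].
  have /andP[mul_lt nu_lt] := coarseT.
  pose r := approx_decr f P (x k).
  have r0 : 0 < r by exact: lt_trans nu_lt.
  have dn : local_norm f (x k) (coarse_dir f P (x k)) = r.
    exact: local_norm_coarse_dir.
  have dg : dotv (grad f (x k)) (coarse_dir f P (x k)) = - r ^+ 2.
    exact: dotv_coarse_dir.
  have rl : r <= lam by exact: direction_norm_le r0 dn dg.
  split=> //; rewrite ?coarseT// => hl _.
  - have mr : 0 < mu * eta < r.
      rewrite mulr_gt0//=; apply: lt_trans mul_lt.
      by rewrite ltr_pM2l.
    rewrite xS; exact: backtracking_decrease r0 dn dg _ _ _ _ alpha_bd beta01
      mr bt.
  - have l0 : 0 < lam by exact: lt_le_trans rl.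
    have l1 : lam < 1 by lra.
    have r1 : r < 1 by exact: le_lt_trans l1.
    have t1 : t k = 1.
      apply: (backtracking_unit_step f_sc f_strict r0 dn dg alpha_bd _ bt).
      by apply: le_trans eta2; exact: le_trans hl.
    split=> //; last first.
      by apply: contraction_lt => //; exact: le_trans eta1.
    rewrite /lam1 xS t1 scale1r.
    apply: le_trans (newton_decr_step f_sc f_strict r0 dn dg r1) _.
    exact: coarse_contraction.
(* A zero decrement would satisfy the stopping test, as [tol] is positive, and the iteration would
   not be performed. *)
have lam0 : 0 < lam.
  rewrite lt_def lam_ge0 andbT; apply/eqP => lamz.
  have := perf k (leqnn k);
    rewrite /sigma_stops /sigma_dir -/coarse (negbTE coarseF).
  rewrite dotv_newton_dir// -/lam lamz expr0n oppr0 oppr0 => /negP[].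
  by rewrite ltW// (lt_trans nu0).
have dn : local_norm f (x k) (newton_dir f (x k)) = lam.
  exact: local_norm_newton_dir.
have dg : dotv (grad f (x k)) (newton_dir f (x k)) = - lam ^+ 2.
  exact: dotv_newton_dir.
split=> //; rewrite ?(negbTE coarseF)// => hl _.
  rewrite xS; apply: (backtracking_decrease f_sc f_strict lam0 dn dg alpha_bd
    beta01 _ bt).
  by rewrite eta0.
have l1 : lam < 1 by lra.
have t1 : t k = 1.
  apply: (backtracking_unit_step f_sc f_strict lam0 dn dg alpha_bd _ bt).
  exact: le_trans eta2.
split=> //.
  rewrite /lam1 xS t1 scale1r.
  apply: le_trans (newton_decr_step f_sc f_strict lam0 dn dg l1) _.
  (* For the Newton direction [r = lam], so the residual term vanishes. *)
  rewrite subrr sqrtr0 add0r expr_div_n le_eqVlt; apply/orP; left; apply/eqP.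
  by field; rewrite gt_eqF// subr_gt0.
have le0 : lam <= (1 - 0) / 3 by lra.
have := contraction_lt (lexx 0) lam0 le0.
by rewrite add0r expr_div_n expr2 mulrAC.
Qed.
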